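(* For all $n\ge0$ the first associated functions of the deformed Cauchy-Laguerre system satisfy, with $x,y\in\mathbb C\setminus[0,\infty)$ held fixed, $$\partial_{s} P^{(1)}_{n}(x) = \xi s^{a}e^{-s} P_{n}(s) \left[ \tfrac{1}{2}P^{(1)}_{n}(x)Q^{(1)}_{n}(-s) + K^{1,1}_{n-1}(x,-s) \right],$$ $$\partial_{s} Q^{(1)}_{n}(y) = \xi s^{a}e^{-s} Q^{(1)}_{n}(-s) \left[ \tfrac{1}{2}P_{n}(s)Q^{(1)}_{n}(y) + K^{0,1}_{n-1}(s,y) \right],$$ $$\partial_{t} P^{(1)}_{n}(x) = \psi t^{b}e^{-t} P^{(1)}_{n}(-t) \left[ \tfrac{1}{2}P^{(1)}_{n}(x)Q_{n}(t) + K^{1,0}_{n-1}(x,t) \right],$$ $$\partial_{t} Q^{(1)}_{n}(y) = \psi t^{b}e^{-t} Q_{n}(t) \left[ \tfrac{1}{2}P^{(1)}_{n}(-t)Q^{(1)}_{n}(y) + K^{1,1}_{n-1}(-t,y) \right].$$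
   Context: Fix $a,b,\xi,\psi\in\mathbb C$ with $\Re a,\Re b>-1$. For $s,t>0$ put $w_1(x)=(1-\xi\chi_{x>s})x^ae^{-x}$, $w_2(y)=(1-\psi\chi_{y>t})y^be^{-y}$ on $(0,\infty)$, $\langle f,g\rangle=\int_0^\infty\int_0^\infty\frac{w_1(x)w_2(y)}{x+y}f(x)g(y)\,dx\,dy$, $M_{j,k}=\langle x^j,y^k\rangle$, $Z_0=1$, $Z_n=\det(M_{j,k})_{0\le j,k\le n-1}$. $P_n,Q_n$ are polynomials of degree $n$ with the same leading coefficient $S_n$ ($S_n^2=Z_n/Z_{n+1}$, branch chosen differentiably in $(s,t)$) and $\langle P_m,Q_n\rangle=\delta_{m,n}$; they depend on $(s,t)$ ranging over an open set on which the standing generic conditions hold: all $M_{j,k}$ finite (absolutely convergent), $Z_n\ne0$, and $\int w_1P_n\ne0$, $\int w_2Q_n\neq0$ for all $n\ge0$. $P^{(1)}_n(z)=\int_0^\infty\frac{w_1(x)}{z-x}P_n(x)\,dx$, $Q^{(1)}_n(z)=\int_0^\infty\frac{w_2(y)}{z-y}Q_n(y)\,dy$. $K^{0,1}_n(x,y)=\sum_{l=0}^nP_l(x)Q^{(1)}_l(y)$, $K^{1,0}_n(x,y)=\sum_{l=0}^nP^{(1)}_l(x)Q_l(y)$, $K^{1,1}_n(x,y)=\sum_{l=0}^nP^{(1)}_l(x)Q^{(1)}_l(y)+\frac1{x+y}$ (for index $-1$ the sums are empty, so $K^{1,1}_{-1}=\frac{1}{x+y}$ and the others vanish). *)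

(* Defs.v *)
From HB Require Import structures.
From mathcomp Require Import all_boot all_order all_algebra.
From mathcomp Require Import all_classical all_reals all_analysis.
From mathcomp Require Export complex.
Import Order.TTheory GRing.Theory Num.Theory.
Import numFieldNormedType.Exports.

Set Implicit Arguments.
Unset Strict Implicit.
Unset Printing Implicit Defensive.

Local Open Scope classical_set_scope.
Local Open Scope ring_scope.
Local Open Scope complex_scope.

(* Lebesgue integrals of complex-valued functions; mu.-integrable carries
   measurability, so Cintegrable is absolute convergence. *)
Definition Cintegral d (T : measurableType d) (R : realType)
    (mu : {measure set T -> \bar R}) (D : set T) (f : T -> R[i]) : R[i] :=
  (Rintegral mu D (fun x => complex.Re (f x)))
    +i* (Rintegral mu D (fun x => complex.Im (f x))).

Definition Cintegrable d (T : measurableType d) (R : realType)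
    (mu : {measure set T -> \bar R}) (D : set T) (f : T -> R[i]) : Prop :=
  mu.-integrable D (fun x => (complex.Re (f x))%:E) /\
  mu.-integrable D (fun x => (complex.Im (f x))%:E).

Definition is_Cderive (R : realType) (f : R -> R[i]) (x : R) (l : R[i]) : Prop :=
  is_derive x 1 (fun u => complex.Re (f u)) (complex.Re l) /\
  is_derive x 1 (fun u => complex.Im (f u)) (complex.Im l).

(* real (Frechet) differentiability of a complex-valued function of (s, t) *)
Definition Cdifferentiable2 (R : realType) (f : R -> R -> R[i]) (s t : R) : Prop :=
  differentiable (fun p : R * R => complex.Re (f p.1 p.2)) (s, t) /\
  differentiable (fun p : R * R => complex.Im (f p.1 p.2)) (s, t).

(* x^a = exp (a ln x) for complex a; only meaningful for x > 0 *)
Definition cpow (R : realType) (x : R) (a : R[i]) : R[i] :=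
  (expR (complex.Re a * ln x))%:C *
  (cos (complex.Im a * ln x) +i* sin (complex.Im a * ln x)).

Definition laguerre (R : realType) (a : R[i]) (x : R) : R[i] :=
  cpow x a * (expR (- x))%:C.

(* w_1 = weight a xi s and w_2 = weight b psi t *)
Definition weight (R : realType) (a xi : R[i]) (s x : R) : R[i] :=
  (1 - xi * (s < x)%R%:R) * laguerre a x.

Definition halfline (R : realType) : set R := `]0, +oo[.

Definition bracket_density (R : realType) (a b xi psi : R[i]) (s t : R)
    (f g : R -> R[i]) (p : R * R) : R[i] :=
  weight a xi s p.1 * weight b psi t p.2 / (p.1 + p.2)%:C * f p.1 * g p.2.

Definition bracket (R : realType) (a b xi psi : R[i]) (s t : R)
    (f g : R -> R[i]) : R[i] :=
  Cintegral (@lebesgue_measure R \x @lebesgue_measure R)%E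
    (@halfline R `*` @halfline R) (bracket_density a b xi psi s t f g).

Definition bracket_converges (R : realType) (a b xi psi : R[i]) (s t : R)
    (f g : R -> R[i]) : Prop :=
  Cintegrable (@lebesgue_measure R \x @lebesgue_measure R)%E
    (@halfline R `*` @halfline R) (bracket_density a b xi psi s t f g).

Definition monomial (R : realType) (j : nat) (x : R) : R[i] := (x ^+ j)%:C.

Definition polyfun (R : realType) (p : {poly R[i]}) (x : R) : R[i] := p.[x%:C].

Definition moment (R : realType) (a b xi psi : R[i]) (s t : R) (j k : nat) : R[i] :=
  bracket a b xi psi s t (monomial j) (monomial k).

Definition Zdet (R : realType) (a b xi psi : R[i]) (s t : R) (n : nat) : R[i] :=
  \det (\matrix_(j < n, k < n) moment a b xi psi s t j k).

Definition weight_integral (R : realType) (a xi : R[i]) (s : R)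
    (p : {poly R[i]}) : R[i] :=
  Cintegral (@lebesgue_measure R) (@halfline R)
    (fun x => weight a xi s x * p.[x%:C]).

(* First associated function: P^(1) = assoc1 a xi s P, Q^(1) = assoc1 b psi t Q *)
Definition assoc1 (R : realType) (a xi : R[i]) (s : R) (p : {poly R[i]})
    (z : R[i]) : R[i] :=
  Cintegral (@lebesgue_measure R) (@halfline R)
    (fun x => weight a xi s x / (z - x%:C) * p.[x%:C]).

Definition cut_plane (R : realType) : set R[i] :=
  ~` ((fun r : R => r%:C) @` `[0, +oo[).

(* The kernels are parametrised by their number of terms: Kij _ _ m is the
   kernel of index m - 1, so that m = 0 gives index -1. Here p, q are the
   sequences of functions P_l, Q_l and p1, q1 their associated functions. *)
Definition K01 (R : realType) (p q1 : nat -> R[i] -> R[i]) (m : nat)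
    (x y : R[i]) : R[i] := \sum_(l < m) p l x * q1 l y.

Definition K10 (R : realType) (p1 q : nat -> R[i] -> R[i]) (m : nat)
    (x y : R[i]) : R[i] := \sum_(l < m) p1 l x * q l y.

Definition K11 (R : realType) (p1 q1 : nat -> R[i] -> R[i]) (m : nat)
    (x y : R[i]) : R[i] := \sum_(l < m) p1 l x * q1 l y + (x + y)^-1.

(* Main.v *)
Require Import Defs.
From HB Require Import structures.
From mathcomp Require Import all_boot all_order all_algebra.
From mathcomp Require Import all_classical all_reals all_analysis.
From mathcomp Require Import measurable_realfun ring lra.
Import Order.TTheory GRing.Theory Num.Theory.
Import numFieldNormedType.Exports.

Local Open Scope classical_set_scope.
Local Open Scope ring_scope.
Local Open Scope complex_scope.

(** Fix [t] and let [B_u] be the pairing at [(u, t)]. Since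
    [w_1 = (1 - xi * 1_(x > u)) x^a e^(-x)], Fubini and the fundamental theorem
    of calculus give
    [d/du B_u(f, g) = - xi s^a e^(-s) f(s) g^(1)(-s)] at [u = s].
    Writing [P_n(u) = \sum_(k <= n) c_k(u) P_k(s)], biorthogonality at [u] against
    the [Q_l(s)] says that the row [c(u)] times the Gram matrix [B_u(P_k(s), Q_l(s))]
    is [S_n(s) / S_n(u)] times the last unit row, while comparing leading
    coefficients gives [c_n(u) = S_n(u) / S_n(s)]. The Gram matrix is the identity
    at [u = s], so Cramer's rule makes [c] differentiable and differentiating the
    linear system yields [c'(s)]; the reciprocity of the two ratios is the origin
    of the factor 1/2 on the diagonal. No moment determinant is ever
    differentiated. The [t]-derivatives are the [s]-derivatives of the system with
    the two weights exchanged. *)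

Set Implicit Arguments.
Unset Strict Implicit.

(** * Real and imaginary parts of complex arithmetic *)

Section ComplexParts.
Variable R : rcfType.
Implicit Types x y : R[i].

Lemma cReM x y : complex.Re (x * y) =
  complex.Re x * complex.Re y - complex.Im x * complex.Im y.
Proof. by case: x => ? ?; case: y. Qed.

Lemma cImM x y : complex.Im (x * y) =
  complex.Re x * complex.Im y + complex.Im x * complex.Re y.
Proof. by case: x => ? ?; case: y. Qed.

Lemma cReD x y : complex.Re (x + y) = complex.Re x + complex.Re y.
Proof. by case: x => ? ?; case: y. Qed.

Lemma cImD x y : complex.Im (x + y) = complex.Im x + complex.Im y.
Proof. by case: x => ? ?; case: y. Qed.

Lemma cReN x : complex.Re (- x) = - complex.Re x.
Proof. by case: x. Qed.

Lemma cImN x : complex.Im (- x) = - complex.Im x.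
Proof. by case: x. Qed.

Lemma cReV x : complex.Re x^-1 =
  complex.Re x / (complex.Re x ^+ 2 + complex.Im x ^+ 2).
Proof. by case: x. Qed.

Lemma cImV x : complex.Im x^-1 =
  - (complex.Im x / (complex.Re x ^+ 2 + complex.Im x ^+ 2)).
Proof. by case: x. Qed.

Lemma complex_ext x y :
  complex.Re x = complex.Re y -> complex.Im x = complex.Im y -> x = y.
Proof. by case: x => ? ?; case: y => ? ? /= -> ->. Qed.

Lemma sum_sqr_parts_neq0 x : x != 0 -> complex.Re x ^+ 2 + complex.Im x ^+ 2 != 0.
Proof.
apply: contraNneq => /eqP; rewrite paddr_eq0 ?sqr_ge0// !sqrf_eq0.
by move=> /andP[/eqP h1 /eqP h2]; apply/eqP/complex_ext.
Qed.

End ComplexParts.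

(** * Complex-valued functions of a real variable: differentiation *)

Section ComplexDerive.
Variable R : realType.
Implicit Types (f g : R -> R[i]) (x : R) (l m c : R[i]).

(** Serves where a derivative only has to exist, its value being found afterwards by differentiating
    an identity. *)
Definition Cderivable f x := exists l, is_Cderive f x l.

Lemma is_Cderive_cst c x : is_Cderive (fun=> c) x 0.
Proof. by split; exact: is_derive_cst. Qed.

Lemma is_Cderive_eq f x l m : is_Cderive f x l -> l = m -> is_Cderive f x m.
Proof. by move=> h <-. Qed.

Lemma is_CderiveD f g x l m : is_Cderive f x l -> is_Cderive g x m ->
  is_Cderive (fun u => f u + g u) x (l + m).
Proof.
move=> [f1 f2] [g1 g2]; split.
- under eq_fun do rewrite cReD; rewrite cReD; exact: is_deriveD.
- under eq_fun do rewrite cImD; rewrite cImD; exact: is_deriveD.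
Qed.

Lemma is_CderiveM f g x l m : is_Cderive f x l -> is_Cderive g x m ->
  is_Cderive (fun u => f u * g u) x (l * g x + f x * m).
Proof.
move=> [f1 f2] [g1 g2]; split.
- under eq_fun do rewrite cReM.
  apply: (is_derive_eq (is_deriveB (is_deriveM f1 g1) (is_deriveM f2 g2))).
  by rewrite cReD !cReM /GRing.scale/=; ring.
- under eq_fun do rewrite cImM.
  apply: (is_derive_eq (is_deriveD (is_deriveM f1 g2) (is_deriveM f2 g1))).
  by rewrite cImD !cImM /GRing.scale/=; ring.
Qed.

Lemma is_Cderive_sum n (f : 'I_n -> R -> R[i]) x (l : 'I_n -> R[i]) :
  (forall i, is_Cderive (f i) x (l i)) ->
  is_Cderive (fun u => \sum_(i < n) f i u) x (\sum_(i < n) l i).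
Proof.
elim: n f l => [|n ih] f l h.
  under eq_fun do rewrite big_ord0.
  by rewrite big_ord0; exact: is_Cderive_cst.
under eq_fun do rewrite big_ord_recl.
by rewrite big_ord_recl; apply: is_CderiveD => //; exact: ih.
Qed.

Lemma near_eq_is_Cderive f g x l : (\forall u \near x, f u = g u) ->
  is_Cderive f x l -> is_Cderive g x l.
Proof.
by move=> fg [f1 f2]; split; [move: f1|move: f2]; apply: near_eq_is_derive;
  apply: filterS fg => u ->.
Qed.

Lemma is_Cderive_unique f x l m : is_Cderive f x l -> is_Cderive f x m -> l = m.
Proof.
move=> [[_ f1] [_ f2]] [[_ g1] [_ g2]].
by apply: complex_ext; [rewrite -f1 -g1|rewrite -f2 -g2].
Qed.

Lemma derivable_Cderivable f x :
  derivable (fun u => complex.Re (f u)) x 1 ->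
  derivable (fun u => complex.Im (f u)) x 1 -> Cderivable f x.
Proof.
move=> /derivableP f1 /derivableP f2.
by exists ('D_1 (fun u => complex.Re (f u)) x +i* 'D_1 (fun u => complex.Im (f u)) x).
Qed.

Lemma Cderivable_cst c x : Cderivable (fun=> c) x.
Proof. by exists 0; exact: is_Cderive_cst. Qed.

Lemma CderivableD f g x : Cderivable f x -> Cderivable g x ->
  Cderivable (fun u => f u + g u) x.
Proof. by move=> [l fl] [m gm]; exists (l + m); exact: is_CderiveD. Qed.

Lemma CderivableM f g x : Cderivable f x -> Cderivable g x ->
  Cderivable (fun u => f u * g u) x.
Proof. by move=> [l fl] [m gm]; eexists; exact: is_CderiveM fl gm. Qed.

Lemma Cderivable_sumr (I : Type) (r : seq I) (f : I -> R -> R[i]) x :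
  (forall i, Cderivable (f i) x) ->
  Cderivable (fun u => \sum_(i <- r) f i u) x.
Proof.
move=> h; elim: r => [|i r ih].
  under eq_fun do rewrite big_nil; exact: Cderivable_cst.
by under eq_fun do rewrite big_cons; exact: CderivableD.
Qed.

Lemma Cderivable_prod (I : Type) (r : seq I) (f : I -> R -> R[i]) x :
  (forall i, Cderivable (f i) x) ->
  Cderivable (fun u => \prod_(i <- r) f i u) x.
Proof.
move=> h; elim: r => [|i r ih].
  under eq_fun do rewrite big_nil; exact: Cderivable_cst.
by under eq_fun do rewrite big_cons; exact: CderivableM.
Qed.

Lemma derivable_sum_sqr_parts f x : Cderivable f x ->
  derivable (fun u => complex.Re (f u) ^+ 2 + complex.Im (f u) ^+ 2) x 1.
Proof.
by move=> [l [f1 f2]]; have [] := is_deriveD (is_deriveX 2 f1) (is_deriveX 2 f2).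
Qed.

Lemma CderivableV f x : f x != 0 -> Cderivable f x ->
  Cderivable (fun u => (f u)^-1) x.
Proof.
move=> /sum_sqr_parts_neq0 h0 df.
have dv := @is_deriveV R (fun u => complex.Re (f u) ^+ 2 + complex.Im (f u) ^+ 2)
  _ _ _ h0 (derivableP (derivable_sum_sqr_parts df)).
have [l [f1 f2]] := df.
eexists (_ +i* _); split.
- under eq_fun do rewrite cReV.
  exact: is_deriveM f1 dv.
- under eq_fun do rewrite cImV.
  exact: is_deriveN (is_deriveM f2 dv).
Qed.

(** The Leibniz formula presents the determinant as a sum of products of entries. *)
Lemma Cderivable_det n (M : R -> 'M[R[i]]_n) x :
  (forall i j, Cderivable (fun u => M u i j) x) ->
  Cderivable (fun u => \det (M u)) x.
Proof.
move=> h; apply: Cderivable_sumr => s.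
by apply: CderivableM; [exact: Cderivable_cst|exact: Cderivable_prod].
Qed.

(** The squared modulus is a continuous real function, nonzero at [x] and hence nearby. *)
Lemma near_Cderivable_neq0 f x : Cderivable f x -> f x != 0 ->
  \forall u \near x, f u != 0.
Proof.
move=> /derivable_sum_sqr_parts/derivable1_diffP/differentiable_continuous cf.
move=> /sum_sqr_parts_neq0 /(cvgr_neq0 _ cf).
by apply: filterS => u; apply: contra_neq => ->; rewrite expr0n addr0.
Qed.

End ComplexDerive.

(** * Linearity and integrability for complex-valued integrals *)

Section ComplexIntegral.
Context d (T : measurableType d) (R : realType).
Variables (mu : {measure set T -> \bar R}) (D : set T).
Hypothesis mD : measurable D.
Implicit Types (f g : T -> R[i]) (c : R[i]).

Lemma eq_Cintegrable f g : {in D, f =1 g} ->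
  Cintegrable mu D f -> Cintegrable mu D g.
Proof.
by move=> fg [f1 f2]; split; [move: f1|move: f2]; apply: eq_integrable => // x xD;
  rewrite fg.
Qed.

Lemma eq_Cintegral f g : {in D, f =1 g} ->
  Cintegral mu D f = Cintegral mu D g.
Proof.
by move=> fg; apply: complex_ext => /=; apply: eq_Rintegral => x xD; rewrite fg.
Qed.

Lemma CintegrableD f g : Cintegrable mu D f -> Cintegrable mu D g ->
  Cintegrable mu D (fun x => f x + g x).
Proof.
move=> [f1 f2] [g1 g2]; split.
- by apply: eq_integrable (integrableD mD f1 g1) => // x _; rewrite /= cReD.
- by apply: eq_integrable (integrableD mD f2 g2) => // x _; rewrite /= cImD.
Qed.

Lemma CintegralD f g : Cintegrable mu D f -> Cintegrable mu D g ->
  Cintegral mu D (fun x => f x + g x) = Cintegral mu D f + Cintegral mu D g.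
Proof.
move=> [f1 f2] [g1 g2]; apply: complex_ext => /=.
- by rewrite -RintegralD//; apply: eq_Rintegral => x _; rewrite cReD.
- by rewrite -RintegralD//; apply: eq_Rintegral => x _; rewrite cImD.
Qed.

Lemma CintegrableZ c f : Cintegrable mu D f -> Cintegrable mu D (fun x => c * f x).
Proof.
move=> [f1 f2]; split.
- apply: eq_integrable (integrableB mD (integrableZl mD (complex.Re c) f1)
    (integrableZl mD (complex.Im c) f2)) => // x _.
  by rewrite /= cReM.
- apply: eq_integrable (integrableD mD (integrableZl mD (complex.Re c) f2)
    (integrableZl mD (complex.Im c) f1)) => // x _.
  by rewrite /= cImM.
Qed.

Lemma CintegralZ c f : Cintegrable mu D f ->
  Cintegral mu D (fun x => c * f x) = c * Cintegral mu D f.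
Proof.
move=> [f1 f2].
have zl r h : mu.-integrable D (fun x => (h x)%:E) ->
  mu.-integrable D (fun x => (r * h x)%:E).
  by move=> /(integrableZl mD r); apply: eq_integrable => // x _; rewrite EFinM.
apply: complex_ext; rewrite /= ?cReM ?cImM /=.
- rewrite -!RintegralZl// -RintegralB//; try exact: zl.
  by apply: eq_Rintegral => x _; rewrite cReM.
- rewrite -!RintegralZl// -RintegralD//; try exact: zl.
  by apply: eq_Rintegral => x _; rewrite cImM.
Qed.

Lemma Cintegrable0 : Cintegrable mu D (fun=> 0).
Proof. by split; exact: integrable0. Qed.

Lemma Cintegral0 : Cintegral mu D (fun=> 0) = 0.
Proof. by apply: complex_ext; rewrite /= Rintegral_cst// mul0r. Qed.

Lemma Cintegrable_sum n (F : 'I_n -> T -> R[i]) :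
  (forall i, Cintegrable mu D (F i)) ->
  Cintegrable mu D (fun x => \sum_(i < n) F i x).
Proof.
elim: n F => [|n ih] F h.
  by apply: eq_Cintegrable Cintegrable0 => x _; rewrite big_ord0.
apply: eq_Cintegrable (CintegrableD (h ord0) (ih (fun i => F (lift ord0 i)) _)) => //.
by move=> x _; rewrite big_ord_recl.
Qed.

Lemma Cintegral_sum n (F : 'I_n -> T -> R[i]) :
  (forall i, Cintegrable mu D (F i)) ->
  Cintegral mu D (fun x => \sum_(i < n) F i x) = \sum_(i < n) Cintegral mu D (F i).
Proof.
elim: n F => [|n ih] F h.
  by rewrite big_ord0 -[RHS]Cintegral0; apply: eq_Cintegral => x _; rewrite big_ord0.
rewrite big_ord_recl -ih// -CintegralD//; last exact: Cintegrable_sum.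
by apply: eq_Cintegral => x _; rewrite big_ord_recl.
Qed.

Definition bounded_measurable (g : T -> R) :=
  measurable_fun D g /\ exists M, forall x, D x -> `|g x| <= M.

Lemma integrableM_bounded (h g : T -> R) : bounded_measurable g ->
  mu.-integrable D (fun x => (h x)%:E) ->
  mu.-integrable D (fun x => (h x * g x)%:E).
Proof.
move=> [mg [M gM]] hi; apply: eq_integrable (integrableMl mD hi mg _) => //.
exists M; split; first exact: num_real.
by move=> r Mr x Dx; exact: le_trans (gM _ Dx) (ltW Mr).
Qed.

Lemma CintegrableM_bounded f g :
  bounded_measurable (fun x => complex.Re (g x)) ->
  bounded_measurable (fun x => complex.Im (g x)) ->
  Cintegrable mu D f -> Cintegrable mu D (fun x => f x * g x).
Proof.
move=> g1 g2 [f1 f2]; split.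
- apply: eq_integrable (integrableB mD (integrableM_bounded g1 f1)
    (integrableM_bounded g2 f2)) => // x _.
  by rewrite /= cReM.
- apply: eq_integrable (integrableD mD (integrableM_bounded g2 f1)
    (integrableM_bounded g1 f2)) => // x _.
  by rewrite /= cImM.
Qed.

End ComplexIntegral.

(** * Derivative of a real integral with respect to its cut-off *)

Section TruncatedIntegral.
Variable R : realType.
Notation mu := (@lebesgue_measure R).
Notation D := (@halfline R).

Lemma measurable_halfline : @measurable _ (measurableTypeR R) D.
Proof. exact: measurable_itv. Qed.

(* Between two cut-offs [u0 <= u] the integrands differ by [k] on ]u0, u] only. *)
Lemma is_derive_truncated_integral (A k : R -> R) (s : R) : 0 < s ->
  (\forall u \near s,
    mu.-integrable D (fun x => (A x - (u < x)%R%:R * k x)%:E)) ->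
  {for s, continuous k} ->
  is_derive s 1 (fun u => Rintegral mu D (fun x => A x - (u < x)%R%:R * k x)) (k s).
Proof.
move=> s0 [e /= e0 intF] ks.
have mD := measurable_halfline.
pose F u x := A x - (u < x)%R%:R * k x.
(* The bound [s / 2] keeps []u0, u]] inside the half-line; halving [e] keeps both endpoints strictly
   inside the ball where integrability is known. *)
pose u0 := Num.max (s - e / 2) (s / 2); pose u1 := s + e / 2.
have u0s : u0 < s by rewrite /u0 gt_max; apply/andP; split; lra.
have u0p : 0 < u0 by rewrite /u0 lt_max; apply/orP; right; lra.
have su1 : s < u1 by rewrite /u1; lra.
have inti u : u0 <= u <= u1 -> mu.-integrable D (fun x => (F u x)%:E).
  move=> /andP[h1 h2]; apply: intF => /=.
  have : s - e / 2 <= u by apply: le_trans h1; rewrite /u0 le_max lexx.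
  by move: h2; rewrite /u1 ltr_distlC => ? ?; apply/andP; split; lra.
have sub u : `]u0, u] `<=` D.
  by move=> x; rewrite /halfline /= !in_itv/= andbT => /andP[h _]; exact: lt_trans h.
have diffF u x : u0 <= u -> F u x - F u0 x = (k \_ `]u0, u]) x.
  move=> u0u; rewrite /F patchE mem_setE in_itv/= (ltNge u x).
  case: ltP => h0; case: leP => h1 /=; rewrite -?[point]/(0 : R); try ring.
  by have := le_lt_trans h0 (le_lt_trans u0u h1); rewrite ltxx.
have intk : mu.-integrable `]u0, u1] (EFin \o k).
  have h := integrableB mD (inti u1 _) (inti u0 _).
  have {}h : mu.-integrable `]u0, u1] (fun x => ((F u1 x)%:E - (F u0 x)%:E)%E).
    apply: integrableS (h _ _) => //. 
    - by rewrite (ltW (lt_trans u0s su1)) lexx.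
    - by rewrite (ltW (lt_trans u0s su1)) lexx.
  apply: eq_integrable h => // x xI.
  rewrite -EFinB diffF ?patchE ?xI//; exact: ltW (lt_trans u0s su1).
have [dk kE] := @continuous_FTC1 _ k (BRight u0) s u1 su1 intk u0s ks.
(* For [u] in [[u0, u1]] the truncated integral is its value at [u0] plus the integral of [k] over
   []u0, u]], so the fundamental theorem of calculus applies to the second term. *)
have dk1 : is_derive s 1
    (fun u => Rintegral mu `]u0, u] k + Rintegral mu D (F u0)) (k s).
  rewrite -[k s]addr0; apply: is_deriveD.
  apply: DeriveDef; [exact: dk|by rewrite -derive1E; exact: kE].
apply: near_eq_is_derive dk1.
near=> u.
have u0u : u0 <= u by near: u; have := lt_nbhsr u0s; apply: filterS => z /ltW.
have uu1 : u <= u1 by near: u; have := lt_nbhsl su1; apply: filterS => z /ltW.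
have -> : Rintegral mu `]u0, u] k = Rintegral mu D (k \_ `]u0, u]).
  by rewrite -Rintegral_mkcondr setIidr.
apply/eqP; rewrite eq_sym -subr_eq -RintegralB//; last 2 first.
- by apply: inti; rewrite u0u uu1.
- by apply: inti; rewrite lexx (le_trans u0u).
by apply/eqP/eq_Rintegral => x _; exact: diffF.
Unshelve. all: by end_near. Qed.

End TruncatedIntegral.

(** * Regularity of the Laguerre weight and of the Cauchy kernel *)

Section ComplexContinuity.
Variable R : realType.
Notation D := (@halfline R).
Implicit Types (f g : R -> R[i]) (s : R) (a c z : R[i]).

Definition Ccontinuous f s :=
  {for s, continuous (fun x => complex.Re (f x))} /\
  {for s, continuous (fun x => complex.Im (f x))}.

Lemma CcontinuousM f g s : Ccontinuous f s -> Ccontinuous g s ->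
  Ccontinuous (fun x => f x * g x) s.
Proof.
move=> [f1 f2] [g1 g2]; split.
- have /funext -> : (fun x => complex.Re (f x * g x)) =1 (fun x =>
      complex.Re (f x) * complex.Re (g x) - complex.Im (f x) * complex.Im (g x)).
    by move=> x; rewrite cReM.
  exact: continuousB (continuousM f1 g1) (continuousM f2 g2).
- have /funext -> : (fun x => complex.Im (f x * g x)) =1 (fun x =>
      complex.Re (f x) * complex.Im (g x) + complex.Im (f x) * complex.Re (g x)).
    by move=> x; rewrite cImM.
  exact: continuousD (continuousM f1 g2) (continuousM f2 g1).
Qed.

Lemma Ccontinuous_cst c s : Ccontinuous (fun=> c) s.
Proof. by split; exact: cst_continuous. Qed.

Lemma Cderivable_continuous f s : Cderivable f s -> Ccontinuous f s.
Proof.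
by move=> [l [[/derivable1_diffP/differentiable_continuous f1 _]
  [/derivable1_diffP/differentiable_continuous f2 _]]].
Qed.

Lemma Cderivable_real (f : R -> R) s : derivable f s 1 ->
  Cderivable (fun x => (f x)%:C) s.
Proof.
move=> df; exists ('D_1 f s)%:C; split; first exact: derivableP.
exact: is_derive_cst.
Qed.

Lemma Cderivable_horner (p : {poly R[i]}) s : Cderivable (fun x => p.[x%:C]) s.
Proof.
elim/poly_ind: p => [|p c ih].
  by under eq_fun do rewrite horner0; exact: Cderivable_cst.
under eq_fun do rewrite hornerD hornerM hornerX hornerC.
apply: CderivableD; last exact: Cderivable_cst.
by apply: CderivableM ih _; exact: Cderivable_real.
Qed.

Lemma Cderivable_laguerre a s : 0 < s -> Cderivable (laguerre a) s.
Proof.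
move=> s0.
have dln (c : R) : is_derive s 1 (fun x => c * ln x) (c * s^-1).
  apply: (is_derive_eq (is_deriveZ c (is_derive1_ln s0))).
  by [].
apply: CderivableM; last first.
  by apply: Cderivable_real.
apply: CderivableM.
  apply: Cderivable_real.
  by have [] := is_derive1_comp (is_derive_expR _) (dln (complex.Re a)).
eexists (_ +i* _); split => /=.
- exact: is_derive1_comp (is_derive_cos _) (dln (complex.Im a)).
- exact: is_derive1_comp (is_derive_sin _) (dln (complex.Im a)).
Qed.

Lemma cut_plane_subr_neq0 z (x : R) : cut_plane z -> 0 <= x -> z - x%:C != 0.
Proof.
move=> cz x0; apply/eqP => /eqP; rewrite subr_eq0 => /eqP zx.
by apply: cz; exists x => //=; rewrite in_itv/= x0.
Qed.

Lemma Cderivable_cauchy_kernel z s : cut_plane z -> 0 <= s ->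
  Cderivable (fun x => (z - x%:C)^-1) s.
Proof.
move=> cz s0; apply: CderivableV; first exact: cut_plane_subr_neq0.
apply: CderivableD; first exact: Cderivable_cst.
under eq_fun do rewrite -rmorphN.
by apply: Cderivable_real.
Qed.

Lemma norm_parts_inv_le z (e : R) : 0 < e ->
  e <= `|complex.Re z| \/ e <= `|complex.Im z| ->
  `|complex.Re z^-1| <= e^-1 /\ `|complex.Im z^-1| <= e^-1.
Proof.
move=> e0 h; rewrite cReV cImV normrN !normrM normfV.
have -> : `|complex.Re z ^+ 2 + complex.Im z ^+ 2| =
    `|complex.Re z| ^+ 2 + `|complex.Im z| ^+ 2.
  by rewrite !real_normK ?num_real// ger0_norm// addr_ge0 ?sqr_ge0.
move: h (normr_ge0 (complex.Re z)) (normr_ge0 (complex.Im z)).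
move: `|complex.Re z| `|complex.Im z| => p q h p0 q0.
have n0 : 0 < p ^+ 2 + q ^+ 2.
  case: h => /(lt_le_trans e0) h.
    by rewrite ltr_pwDl ?exprn_gt0 ?sqr_ge0.
  by rewrite ltr_wpDl ?exprn_gt0 ?sqr_ge0.
rewrite !ler_pdivrMr// ![e^-1 * _]mulrC !ler_pdivlMr//.
(* A hint for [nra]: when [e <= p], the bound [q e <= p^2 + q^2] follows from [q e <= p q] and this
   square; likewise with [p] and [q] exchanged. *)
have pq : 0 <= (p - q) ^+ 2 := sqr_ge0 _.
by split; case: h => h; nra.
Qed.

(** A point off the cut keeps a positive distance from it, which bounds the kernel uniformly;
    measurability comes from continuity on an open set. *)
Lemma bounded_measurable_cauchy_kernel z : cut_plane z ->
  bounded_measurable (D : set (measurableTypeR R))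
    (fun x => complex.Re (z - x%:C)^-1) /\
  bounded_measurable (D : set (measurableTypeR R))
    (fun x => complex.Im (z - x%:C)^-1).
Proof.
move=> cz.
have [e e0 he] : exists2 e : R, 0 < e & forall x, 0 < x ->
    e <= `|complex.Re (z - x%:C)| \/ e <= `|complex.Im (z - x%:C)|.
  (* A real [z] off the cut is negative, so [- Re z] bounds the distance from below; a non-real [z]
     is at distance at least [|Im z|]. *)
  have [z0|z0] := eqVneq (complex.Im z) 0.
    have r0 : complex.Re z < 0.
      rewrite ltNge; apply/negP => r0; apply: cz; exists (complex.Re z) => //=.
        by rewrite in_itv/= r0.
      by apply: complex_ext.
    exists (- complex.Re z); first by rewrite oppr_gt0.
    move=> x x0; left; rewrite cReD cReN /= ler0_norm; lra.
  exists `|complex.Im z|; first by rewrite normr_gt0.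
  by move=> x x0; right; rewrite cImD cImN /= subr0.
have cc x : halfline x -> Ccontinuous (fun x => (z - x%:C)^-1) x.
  rewrite /halfline/= in_itv/= andbT => /ltW x0.
  exact/Cderivable_continuous/Cderivable_cauchy_kernel.
have oD : open D by exact: interval_open.
have mf (f : R -> R) : {in D, continuous f} ->
    @measurable_fun _ _ (measurableTypeR R) _ D f.
  exact: open_continuous_measurable_fun.
have bf (f : R -> R) : (forall x, 0 < x -> `|f x| <= e^-1) ->
    exists M, forall x, D x -> `|f x| <= M.
  by move=> h; exists e^-1 => x; rewrite /halfline/= in_itv/= andbT => /h.
split; split; [apply: mf|apply: bf|apply: mf|apply: bf].
- by move=> x /set_mem/cc[].
- by move=> x /he/(norm_parts_inv_le e0)[].
- by move=> x /set_mem/cc[].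
- by move=> x /he/(norm_parts_inv_le e0)[].
Qed.

End ComplexContinuity.

(** * Moving the jump of the deformed weight *)

Section WeightIntegral.
Variable R : realType.
Notation mu := (@lebesgue_measure R).
Notation D := (@halfline R).

(** The deformed weight is the full Laguerre weight minus [xi] times its restriction to [x > u], so
    each part is a truncated integral. Raising [u] removes less, whence the positive sign. *)
Lemma is_Cderive_weight_integral (a xi : R[i]) (s : R) (h : R -> R[i]) : 0 < s ->
  (\forall u \near s, Cintegrable mu D (fun x => weight a xi u x * h x)) ->
  Ccontinuous h s ->
  is_Cderive (fun u => Cintegral mu D (fun x => weight a xi u x * h x)) s
    (xi * laguerre a s * h s).
Proof.
move=> s0 ih hc.
pose k x := xi * laguerre a x * h x.
have ck : Ccontinuous k s.
  apply: CcontinuousM hc; apply: CcontinuousM; first exact: Ccontinuous_cst.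
  exact/Cderivable_continuous/Cderivable_laguerre.
have weightE u x : weight a xi u x * h x =
    laguerre a x * h x - ((u < x)%R%:R : R)%:C * k x.
  by rewrite /weight /k rmorph_nat; ring.
have reE u x : complex.Re (weight a xi u x * h x) =
    complex.Re (laguerre a x * h x) - (u < x)%R%:R * complex.Re (k x).
  by rewrite weightE cReD cReN [complex.Re (_ * k x)]cReM/= mul0r subr0.
have imE u x : complex.Im (weight a xi u x * h x) =
    complex.Im (laguerre a x * h x) - (u < x)%R%:R * complex.Im (k x).
  by rewrite weightE cImD cImN [complex.Im (_ * k x)]cImM/= mul0r addr0.
split.
- rewrite (_ : (fun u => _) = (fun u => Rintegral mu D (fun x =>
      complex.Re (laguerre a x * h x) - (u < x)%R%:R * complex.Re (k x)))); last first.
    by apply/funext => u; apply: eq_Rintegral => x _; rewrite reE.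
  apply: is_derive_truncated_integral ck.1 => //.
  apply: filterS ih => u -[+ _]; apply: eq_integrable => //.
    exact: measurable_halfline.
  by move=> x _; rewrite reE.
- rewrite (_ : (fun u => _) = (fun u => Rintegral mu D (fun x =>
      complex.Im (laguerre a x * h x) - (u < x)%R%:R * complex.Im (k x)))); last first.
    by apply/funext => u; apply: eq_Rintegral => x _; rewrite imE.
  apply: is_derive_truncated_integral ck.2 => //.
  apply: filterS ih => u -[_]; apply: eq_integrable => //.
    exact: measurable_halfline.
  by move=> x _; rewrite imE.
Qed.

End WeightIntegral.

(** * Fubini's theorem on a product of two measurable sets *)

Section FubiniOnRectangle.
Context d1 d2 (T1 : measurableType d1) (T2 : measurableType d2) (R : realType).
Variables (m1 : {sigma_finite_measure set T1 -> \bar R})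
  (m2 : {sigma_finite_measure set T2 -> \bar R}).
Variables (D1 : set T1) (D2 : set T2).
Hypotheses (mD1 : measurable D1) (mD2 : measurable D2).
Local Open Scope ereal_scope.

Lemma ae_integrable_section (f : T1 * T2 -> \bar R) :
  (m1 \x m2).-integrable (D1 `*` D2) f ->
  {ae m1, forall x, D1 x -> m2.-integrable D2 (fun y => f (x, y))}.
Proof.
move=> /(integrable_mkcond _ (measurableX mD1 mD2)) /ae_integrable1.
apply: filterS => x fi D1x; apply/integrable_mkcond => //.
apply: eq_integrable fi => // y _; rewrite !patchE.
by case: (boolP (y \in D2)) => yD; rewrite ?in_setX (mem_set D1x) ?yD ?(negPf yD).
Qed.

(** The function is extended by zero to the whole product. Integrability of every section over [D1]
    makes all inner integrals finite, so that [Rintegral], which sends infinite values to 0, loses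
    nothing. *)
Lemma fubini_rectangle (f : T1 * T2 -> R) :
  (m1 \x m2).-integrable (D1 `*` D2) (EFin \o f) ->
  (forall x, D1 x -> m2.-integrable D2 (fun y => (f (x, y))%:E)) ->
  m1.-integrable D1 (fun x => (Rintegral m2 D2 (fun y => f (x, y)))%:E) /\
  Rintegral (m1 \x m2) (D1 `*` D2) f =
    Rintegral m1 D1 (fun x => Rintegral m2 D2 (fun y => f (x, y))).
Proof.
move=> fi fxi.
have mD := measurableX mD1 mD2.
have gi := (integrable_mkcond _ mD).1 fi.
set g := _ \_ _ in gi.
have gE x : \int[m2]_y g (x, y) =
    ((fun x => (Rintegral m2 D2 (fun y => f (x, y)))%:E) \_ D1) x.
  rewrite patchE; case: ifPn => [/set_mem D1x|xD1].
    rewrite fineK ?integrable_fin_num//; last exact: fxi.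
    rewrite [RHS]integral_mkcond; apply: eq_integral => y _; rewrite /g !patchE.
    by rewrite in_setX (mem_set D1x).
  rewrite integral0_eq// => y _; rewrite /g patchE in_setX (negPf xD1).
  by [].
split.
  apply/(integrable_mkcond _ mD1).
  by apply: eq_integrable (integrable_fubini_F gi) => // x _; exact: gE.
rewrite /Rintegral integral_mkcond -[X in fine X = _](integral12_prod_meas1 gi).
by rewrite [in RHS]integral_mkcond; congr fine; apply: eq_integral => x _; exact: gE.
Qed.

End FubiniOnRectangle.

(** * Exchanging the two factors of a product measure *)

Section Swap.
Context d1 d2 (T1 : measurableType d1) (T2 : measurableType d2) (R : realType).
Variables (m1 : {sigma_finite_measure set T1 -> \bar R})
  (m2 : {sigma_finite_measure set T2 -> \bar R}).
Local Open Scope ereal_scope.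

(** By Tonelli, integrability can be tested on either iterated integral of the modulus, and the swap
    exchanges these two. *)
Lemma integrable_swapT (f : T1 * T2 -> \bar R) :
  (m1 \x m2).-integrable setT f -> (m2 \x m1).-integrable setT (f \o swap_pair).
Proof.
move=> fi; have mf := measurable_int _ fi.
apply/integrable12ltyP; first by apply: measurableT_comp mf _; exact: measurable_swap.
exact: (integrable21ltyP _ _ mf).1.
Qed.

(** By Fubini both sides equal the same iterated integral. *)
Lemma integral_swapT (f : T1 * T2 -> \bar R) :
  (m1 \x m2).-integrable setT f ->
  \int[m2 \x m1]_z f (swap_pair z) = \int[m1 \x m2]_z f z.
Proof.
move=> fi.
by rewrite -(integral12_prod_meas1 (integrable_swapT fi)) -(integral21_prod_meas1 fi).
Qed.

Variables (D1 : set T1) (D2 : set T2).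
Hypotheses (mD1 : measurable D1) (mD2 : measurable D2).

Let restrict_swap (f : T1 * T2 -> \bar R) z :
  (f \_ (D1 `*` D2)) (swap_pair z) = ((f \o swap_pair) \_ (D2 `*` D1)) z.
Proof. by case: z => y x; rewrite !patchE !in_setX andbC. Qed.

Lemma integrable_swap (f : T1 * T2 -> \bar R) :
  (m1 \x m2).-integrable (D1 `*` D2) f ->
  (m2 \x m1).-integrable (D2 `*` D1) (f \o swap_pair).
Proof.
move=> /(integrable_mkcond _ (measurableX mD1 mD2)) /integrable_swapT fi.
apply/integrable_mkcond; first exact: measurableX.
by apply: eq_integrable fi => // z _; exact: restrict_swap.
Qed.

Lemma Rintegral_swap (f : T1 * T2 -> R) :
  (m1 \x m2).-integrable (D1 `*` D2) (EFin \o f) ->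
  Rintegral (m2 \x m1) (D2 `*` D1) (f \o swap_pair) =
  Rintegral (m1 \x m2) (D1 `*` D2) f.
Proof.
move=> /(integrable_mkcond _ (measurableX mD1 mD2)) fi.
rewrite /Rintegral [in RHS]integral_mkcond -(integral_swapT fi).
by rewrite integral_mkcond; congr fine; apply: eq_integral => z _; rewrite restrict_swap.
Qed.

End Swap.

(** * The Cauchy-Laguerre pairing and its derivative in the first parameter *)

Section Bracket.
Variable R : realType.
Notation mu := (@lebesgue_measure R).
Notation D := (@halfline R).
Implicit Types (a b xi psi : R[i]) (s t : R) (f g : R -> R[i]) (p q : {poly R[i]}).

Let mD : @measurable _ (measurableTypeR R) D.
Proof. exact: measurable_halfline. Qed.

Let halflineE x : D x = (0 < x) :> Prop.
Proof. by rewrite /halfline/= in_itv/= andbT. Qed.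

Lemma laguerre_neq0 a (x : R) : laguerre a x != 0.
Proof.
have r0 (r : R) : (expR r)%:C != 0 :> R[i].
  by rewrite eq_complex /= negb_and gt_eqF ?expR_gt0.
rewrite /laguerre /cpow !mulf_neq0//.
apply/eqP => -[c0 s0]; have := cos2Dsin2 (complex.Im a * ln x).
by rewrite c0 s0 !expr0n addr0 => /eqP; rewrite eq_sym oner_eq0.
Qed.

(** The kernel [1 / (x + y)] is symmetric. This symmetry is what turns every statement about [s] and
    the first weight into one about [t] and the second. *)
Lemma bracket_density_swap a b xi psi s t f g (z : R * R) :
  bracket_density b a psi xi t s g f z =
  bracket_density a b xi psi s t f g (swap_pair z).
Proof. by rewrite /bracket_density /= [z.2 + z.1]addrC; ring. Qed.

Lemma bracket_converges_swap a b xi psi s t f g :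
  bracket_converges a b xi psi s t f g -> bracket_converges b a psi xi t s g f.
Proof.
move=> [/(integrable_swap mD mD) h1 /(integrable_swap mD mD) h2]; split.
- by apply: eq_integrable h1 => [|z _]; [exact: measurableX|
    rewrite /= bracket_density_swap].
- by apply: eq_integrable h2 => [|z _]; [exact: measurableX|
    rewrite /= bracket_density_swap].
Qed.

Lemma bracket_swap a b xi psi s t f g :
  bracket_converges a b xi psi s t f g ->
  bracket b a psi xi t s g f = bracket a b xi psi s t f g.
Proof.
move=> [/(Rintegral_swap mD mD) h1 /(Rintegral_swap mD mD) h2].
apply: complex_ext => /=.
- by rewrite -h1; apply: eq_Rintegral => z _; rewrite /= bracket_density_swap.
- by rewrite -h2; apply: eq_Rintegral => z _; rewrite /= bracket_density_swap.
Qed.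

(** A null set cannot contain []0, s[], which has measure [s]. *)
Lemma ae_witness (P : R -> Prop) s : 0 < s -> {ae mu, forall x, P x} ->
  exists2 x, 0 < x < s & P x.
Proof.
move=> s0 [N [mN N0 PN]]; apply: contrapT => /forall2NP h.
have : (mu `]0%R, s[%classic <= mu N)%E.
  apply: le_measure; rewrite ?inE//.
  move=> x; rewrite /= in_itv/= => xs; apply: PN => /= Px.
  by case: (h x).
by rewrite N0 lebesgue_measure_itv/= lte_fin s0 sube0 lee_fin leNgt s0.
Qed.

Lemma Cintegrable_weight_poly b psi t q :
  (forall k, Cintegrable mu D (fun y => weight b psi t y * monomial k y)) ->
  Cintegrable mu D (fun y => weight b psi t y * q.[y%:C]).
Proof.
move=> h.
have := Cintegrable_sum mD (fun k : 'I_(size q) => CintegrableZ mD q`_k (h k)).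
apply: eq_Cintegrable => // y _; rewrite horner_coef mulr_sumr.
by apply: eq_bigr => k _; rewrite /monomial rmorphXn; ring.
Qed.

Section Converging.
Variables (a b xi psi : R[i]) (s t : R).
Hypothesis s0 : 0 < s.
Hypothesis hM : forall j k,
  bracket_converges a b xi psi s t (monomial j) (monomial k).

(* For almost every [x], [w_2(y) y^j / (x + y)] is integrable for [j = k, k + 1];
   choosing such an [x < s], where [w_1] does not vanish, and using
   [y^k = (x y^k + y^(k + 1)) / (x + y)] gives the integrability of [w_2(y) y^k]. *)
Lemma Cintegrable_weight_poly_right q :
  Cintegrable mu D (fun y => weight b psi t y * q.[y%:C]).
Proof.
apply: Cintegrable_weight_poly => k.
pose section_integrable j x := D x -> Cintegrable mu D (fun y =>
  bracket_density a b xi psi s t (monomial 0) (monomial j) (x, y)).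
have h j : {ae mu, forall x, section_integrable j x}.
  have [h1 h2] := hM 0 j.
  have := ae_integrable_section mD mD h2.
  have := ae_integrable_section mD mD h1.
  by apply: filterS2 => x g1 g2 Dx; split; [exact: g1|exact: g2].
have hh : {ae mu, forall x, section_integrable k x /\ section_integrable k.+1 x}.
  have := h k.+1; have := h k; apply: filterS2.
    exact: (ae_filter_ringOfSetsType mu).
  by move=> x gk gk1; split.
have [x /andP[x0 xs] [hk hk1]] := ae_witness s0 hh.
rewrite /section_integrable halflineE in hk hk1; move: (hk x0) (hk1 x0) => {}hk {}hk1.
have := CintegrableZ mD (laguerre a x)^-1 (CintegrableD mD (CintegrableZ mD x%:C hk) hk1).
apply: eq_Cintegrable => // y /set_mem; rewrite halflineE => y0.
rewrite /bracket_density /weight/= ltNge (ltW xs)/= /monomial expr0 exprS.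
have xy0 : (x + y)%:C != 0 :> R[i].
  by rewrite eq_complex /= negb_and gt_eqF ?addr_gt0.
have := laguerre_neq0 a x; move: xy0; rewrite !rmorphM !rmorphD /= => xy0 l0.
by field; rewrite xy0 l0.
Qed.

Lemma bracket_density_poly p q (z : R * R) :
  bracket_density a b xi psi s t (polyfun p) (polyfun q) z =
  \sum_(j < size p) p`_j * (\sum_(k < size q) q`_k *
    bracket_density a b xi psi s t (monomial j) (monomial k) z).
Proof.
rewrite /bracket_density /polyfun.
under eq_bigr do rewrite mulr_sumr.
rewrite !horner_coef -mulrA big_distrlr/= mulr_sumr.
apply: eq_bigr => j _; rewrite mulr_sumr; apply: eq_bigr => k _.
by rewrite /monomial !rmorphXn; ring.
Qed.

Let mDD := measurableX mD mD.

Lemma bracket_converges_poly p q :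
  bracket_converges a b xi psi s t (polyfun p) (polyfun q).
Proof.
have := Cintegrable_sum mDD (fun j : 'I_(size p) => CintegrableZ mDD p`_j
  (Cintegrable_sum mDD (fun k : 'I_(size q) => CintegrableZ mDD q`_k (hM j k)))).
by apply: eq_Cintegrable => // z _; rewrite bracket_density_poly.
Qed.

Lemma bracket_suml n (c : 'I_n -> R[i]) (P : 'I_n -> {poly R[i]}) q :
  bracket a b xi psi s t (polyfun (\sum_(k < n) c k *: P k)) (polyfun q) =
  \sum_(k < n) c k * bracket a b xi psi s t (polyfun (P k)) (polyfun q).
Proof.
have h k := bracket_converges_poly (P k) q.
transitivity (\sum_(k < n) Cintegral (mu \x mu)%E (D `*` D) (fun z =>
    c k * bracket_density a b xi psi s t (polyfun (P k)) (polyfun q) z)).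
  rewrite -Cintegral_sum//; last by move=> k; exact: (CintegrableZ mDD (c k) (h k)).
  apply: eq_Cintegral => z _; rewrite /bracket_density /polyfun horner_sum.
  rewrite mulr_sumr mulr_suml; apply: eq_bigr => k _.
  by rewrite hornerZ; ring.
by apply: eq_bigr => k _; exact: (CintegralZ mDD (c k) (h k)).
Qed.

Lemma bracket_sumr n (c : 'I_n -> R[i]) (Q : 'I_n -> {poly R[i]}) p :
  bracket a b xi psi s t (polyfun p) (polyfun (\sum_(k < n) c k *: Q k)) =
  \sum_(k < n) c k * bracket a b xi psi s t (polyfun p) (polyfun (Q k)).
Proof.
have h k := bracket_converges_poly p (Q k).
transitivity (\sum_(k < n) Cintegral (mu \x mu)%E (D `*` D) (fun z =>
    c k * bracket_density a b xi psi s t (polyfun p) (polyfun (Q k)) z)).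
  rewrite -Cintegral_sum//; last by move=> k; exact: (CintegrableZ mDD (c k) (h k)).
  apply: eq_Cintegral => z _; rewrite /bracket_density /polyfun horner_sum.
  rewrite mulr_sumr; apply: eq_bigr => k _.
  by rewrite hornerZ; ring.
by apply: eq_bigr => k _; exact: (CintegralZ mDD (c k) (h k)).
Qed.

End Converging.

Lemma cut_plane_opp_real (x : R) : 0 < x -> cut_plane (- x%:C).
Proof.
move=> x0 [r /=]; rewrite in_itv/= andbT => r0 [h _].
by move: r0; rewrite h leNgt oppr_lt0 x0.
Qed.

Section AssociatedFunction.
Variables (b psi : R[i]) (t : R) (q : {poly R[i]}).
Hypothesis qi : Cintegrable mu D (fun y => weight b psi t y * q.[y%:C]).

Lemma Cintegrable_assoc1 z : cut_plane z ->
  Cintegrable mu D (fun y => weight b psi t y / (z - y%:C) * q.[y%:C]).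
Proof.
move=> /bounded_measurable_cauchy_kernel[h1 h2].
by apply: eq_Cintegrable (CintegrableM_bounded mD h1 h2 qi) => // y _; ring.
Qed.

Let kernel_oppE (x y : R) :
  -1 * (weight b psi t y / (- x%:C - y%:C) * q.[y%:C]) =
  weight b psi t y * q.[y%:C] * ((x + y)^-1)%:C.
Proof.
rewrite -opprD -rmorphD invrN fmorphV.
by ring.
Qed.

Lemma Cintegrable_assoc1_opp_real (x : R) : 0 < x ->
  Cintegrable mu D (fun y => weight b psi t y * q.[y%:C] * ((x + y)^-1)%:C).
Proof.
move=> /cut_plane_opp_real/Cintegrable_assoc1/(CintegrableZ mD (-1)).
by apply: eq_Cintegrable => // y _; exact: kernel_oppE.
Qed.

(** Identifies the inner integral of the pairing, with kernel [1 / (x + y)], as minus the associated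
    function at [- x], a point off the cut. *)
Lemma assoc1_opp_real (x : R) : 0 < x ->
  - assoc1 b psi t q (- x%:C) =
  Cintegral mu D (fun y => weight b psi t y * q.[y%:C] * ((x + y)^-1)%:C).
Proof.
move=> /cut_plane_opp_real/Cintegrable_assoc1 h.
rewrite -mulN1r -CintegralZ//; apply: eq_Cintegral => y _; exact: kernel_oppE.
Qed.

(** Dominated convergence: for [x > s / 2] and [y > 0] the kernel is at most [2 / s], so
    [|f| * (2 / s)] dominates the integrand near [s]. *)
Lemma continuous_cauchy_transform (f : R -> R) (s : R) : 0 < s ->
  mu.-integrable D (EFin \o f) ->
  {for s, continuous (fun x => Rintegral mu D (fun y => f y * (x + y)^-1))}.
Proof.
move=> s0 fi.
have sI : s \in (`]s / 2, s + 1[%classic : set R).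
  by rewrite inE/= in_itv/=; apply/andP; split; lra.
pose g y := `|f y| * (2 / s).
have gi : mu.-integrable D (EFin \o g).
  have := integrableZr mD (2 / s) (integrable_norm fi).
  by apply: eq_integrable => // y _.
have fg x y : s / 2 < x -> 0 < y -> `|f y * (x + y)^-1| <= g y.
  move=> sx y0; rewrite normrM ler_wpM2l// ger0_norm ?invr_ge0; last by lra.
  by rewrite -[2 / s]invf_div lef_pV2 ?posrE; lra.
have itvE x : `]s / 2, s + 1[%classic x -> s / 2 < x.
  by rewrite /= in_itv/= => /andP[].
apply: (@continuity_under_integral _ _ _ mu (fun x y => f y * (x + y)^-1) D mD
  (s / 2) (s + 1) _ _ g) => //.
- move=> x /itvE sx; apply: le_integrable gi => //.
    apply/measurable_EFinP; apply: measurable_funM.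
      by apply/measurable_EFinP; exact: measurable_int fi.
    apply: open_continuous_measurable_fun; first exact: interval_open.
    move=> y /set_mem; rewrite -/D halflineE => y0; apply: continuousV; first by lra.
    by apply: continuousD => //; exact: cst_continuous.
  move=> y; rewrite halflineE => y0 /=; rewrite lee_fin.
  by apply: le_trans (fg _ _ sx y0) _; rewrite ler_norm.
- apply: aeW => y; rewrite halflineE => y0 x /set_mem/itvE sx.
  have c1 : {for x, continuous (fun x => (x + y)^-1)}.
    apply: continuousV; first by lra.
    by apply: continuousD => //; exact: cst_continuous.
  exact: continuousM (@cst_continuous _ _ (f y) x) c1.
- move=> x /itvE sx; apply: aeW => y; rewrite halflineE; exact: fg.
Qed.

Lemma near_eq_continuous (f g : R -> R) (s : R) :
  (\forall x \near s, f x = g x) ->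
  {for s, continuous f} -> {for s, continuous g}.
Proof.
move=> fg cf; rewrite /prop_for /continuous_at -(nbhs_singleton fg).
by apply: cvg_trans cf; exact: near_eq_cvg.
Qed.

Lemma Ccontinuous_assoc1 (s : R) : 0 < s ->
  Ccontinuous (fun x => - assoc1 b psi t q (- x%:C)) s.
Proof.
move=> s0; have [q1 q2] := qi.
split.
- apply: near_eq_continuous (continuous_cauchy_transform s0 q1).
  have := lt_nbhsr s0; apply: filterS => x x0; rewrite assoc1_opp_real//=.
  by apply: eq_Rintegral => y _; rewrite [RHS]cReM/= mulr0 subr0.
- apply: near_eq_continuous (continuous_cauchy_transform s0 q2).
  have := lt_nbhsr s0; apply: filterS => x x0; rewrite assoc1_opp_real//=.
  by apply: eq_Rintegral => y _; rewrite [RHS]cImM/= mulr0 add0r.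
Qed.

End AssociatedFunction.

(** Integrating over the second variable first leaves a single integral against the first weight.
    The factor [h] is independent of [s], so for fixed [p] and [q] only the jump of that weight
    moves with [s]. *)
Lemma bracketE a b xi psi s t p q : 0 < s ->
  (forall j k, bracket_converges a b xi psi s t (monomial j) (monomial k)) ->
  let h x := p.[x%:C] * - assoc1 b psi t q (- x%:C) in
  Cintegrable mu D (fun x => weight a xi s x * h x) /\
  bracket a b xi psi s t (polyfun p) (polyfun q) =
    Cintegral mu D (fun x => weight a xi s x * h x).
Proof.
move=> s0 hM h.
have qi := Cintegrable_weight_poly_right s0 hM q.
have [c1 c2] := bracket_converges_poly hM p q.
have densE x y : bracket_density a b xi psi s t (polyfun p) (polyfun q) (x, y) =
    weight a xi s x * p.[x%:C] * (weight b psi t y * q.[y%:C] * ((x + y)^-1)%:C).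
  by rewrite /bracket_density /polyfun fmorphV; ring.
have sectioni x : D x -> Cintegrable mu D (fun y =>
    bracket_density a b xi psi s t (polyfun p) (polyfun q) (x, y)).
  rewrite halflineE => x0.
  apply: eq_Cintegrable (CintegrableZ mD (weight a xi s x * p.[x%:C])
    (Cintegrable_assoc1_opp_real qi x0)) => //.
have sectionE x : D x -> Cintegral mu D (fun y =>
    bracket_density a b xi psi s t (polyfun p) (polyfun q) (x, y)) =
    weight a xi s x * h x.
  rewrite halflineE => x0; rewrite /h mulrA assoc1_opp_real//.
  rewrite -(CintegralZ mD _ (Cintegrable_assoc1_opp_real qi x0)).
  by apply: eq_Cintegral => y _; exact: densE.
have [i1 e1] := fubini_rectangle mD mD c1 (fun x Dx => (sectioni x Dx).1).
have [i2 e2] := fubini_rectangle mD mD c2 (fun x Dx => (sectioni x Dx).2).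
split.
  by split; [apply: eq_integrable i1 => // x|apply: eq_integrable i2 => // x];
    move=> /set_mem/sectionE <-.
apply: complex_ext => /=.
- by rewrite e1; apply: eq_Rintegral => x /set_mem/sectionE <-.
- by rewrite e2; apply: eq_Rintegral => x /set_mem/sectionE <-.
Qed.

Section DeriveFirstParameter.
Variables (a b xi psi : R[i]) (s t : R).
Hypothesis converges_near_s : \forall u \near s, 0 < u /\
  forall j k, bracket_converges a b xi psi u t (monomial j) (monomial k).

Let s0 : 0 < s. Proof. by case: (nbhs_singleton converges_near_s). Qed.

Lemma is_Cderive_bracket p q :
  is_Cderive (fun u => bracket a b xi psi u t (polyfun p) (polyfun q)) s
    (xi * laguerre a s * (p.[s%:C] * - assoc1 b psi t q (- s%:C))).
Proof.
pose h x := p.[x%:C] * - assoc1 b psi t q (- x%:C).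
apply: (@near_eq_is_Cderive _ (fun u => Cintegral mu D (fun x => weight a xi u x * h x))).
  have := converges_near_s; apply: filterS => u [u0 hM].
  by rewrite (bracketE _ _ u0 hM).2.
apply: (is_Cderive_weight_integral (h := h)) => //.
  have := converges_near_s; apply: filterS => u [u0 hM].
  exact: (bracketE p q u0 hM).1.
apply: CcontinuousM; first exact/Cderivable_continuous/Cderivable_horner.
apply: Ccontinuous_assoc1 => //.
have [_ hM] := nbhs_singleton converges_near_s.
exact: (Cintegrable_weight_poly_right _ hM).
Qed.

Lemma is_Cderive_assoc1 p z : 0 < t -> cut_plane z ->
  is_Cderive (fun u => assoc1 a xi u p z) s
    (xi * laguerre a s * (p.[s%:C] / (z - s%:C))).
Proof.
move=> t0 cz.
have assocE u : assoc1 a xi u p z =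
    Cintegral mu D (fun x => weight a xi u x * (p.[x%:C] / (z - x%:C))).
  by apply: eq_Cintegral => x _; ring.
under eq_fun do rewrite assocE.
apply: (is_Cderive_weight_integral (h := fun x => p.[x%:C] / (z - x%:C))) => //.
  have := converges_near_s; apply: filterS => u [u0 hM].
  (* The integrability lemma concerns the second weight; applied to the exchanged pairing, whose
     first cut-off is [t], it yields the claim for the first. *)
  have wi := Cintegrable_weight_poly_right t0
    (fun j k => bracket_converges_swap (hM k j)) p.
  by apply: eq_Cintegrable (Cintegrable_assoc1 wi cz) => // x _; ring.
apply: CcontinuousM; apply/Cderivable_continuous; first exact: Cderivable_horner.
exact: Cderivable_cauchy_kernel (ltW s0).
Qed.

End DeriveFirstParameter.

End Bracket.

(** * Expansions in a polynomial basis with one member of each degree *)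

Lemma coef_lead (F : nzRingType) n (p : {poly F}) :
  size p = n.+1 -> p`_n = lead_coef p.
Proof. by move=> sp; rewrite lead_coefE sp. Qed.

Section GradedBasis.
Variables (F : fieldType) (P : nat -> {poly F}).
Hypothesis sizeP : forall n, size (P n) = n.+1.

Lemma coef_graded_sum n (c : 'I_n.+1 -> F) :
  (\sum_(k < n.+1) c k *: P k)`_n = c ord_max * lead_coef (P n).
Proof.
rewrite coef_sum big_ord_recr/= big1 ?add0r.
  by rewrite coefZ (coef_lead (sizeP n)).
by move=> k _; rewrite coefZ nth_default ?mulr0// sizeP /=.
Qed.

(** Induction on the degree bound: subtracting the right multiple of the top basis member kills the
    top coefficient. *)
Lemma graded_basis_span n (p : {poly F}) : (size p <= n)%N ->
  exists c : 'I_n -> F, p = \sum_(k < n) c k *: P k.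
Proof.
elim: n p => [|n ih] p.
  by rewrite leqn0 size_poly_eq0 => /eqP ->; exists (fun=> 0); rewrite big_ord0.
move=> pn; pose d := p`_n / lead_coef (P n).
have l0 : lead_coef (P n) != 0 by rewrite lead_coef_eq0 -size_poly_eq0 sizeP.
have /ih[c cE] : (size (p - d *: P n)%R <= n)%N.
  apply/leq_sizeP => j; rewrite leq_eqVlt => /orP[/eqP <-|nj].
    by rewrite coefB coefZ (coef_lead (sizeP n)) /d divfK// subrr.
  by rewrite coefB coefZ !nth_default ?mulr0 ?subrr ?sizeP// (leq_trans pn).
(* Indices below [n] keep the inductive coefficients; at the last index [insub] fails and the
   eliminated multiple [d] is used. *)
exists (fun k => if insub (val k) is Some i then c i else d).
rewrite big_ord_recr/= insubN -?leqNgt// -[LHS](subrK (d *: P n)) cE; congr (_ + _).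
by apply: eq_bigr => k _; rewrite /= (insubT (fun i => i < n)%N (ltn_ord k));
  congr (c _ *: _); exact: val_inj.
Qed.

End GradedBasis.

(** * Differentiating the solution of a linear system near the identity *)

(* In the application [E k l u] is [B_u(P_k(s), Q_l(s))], [c] the coordinates of
   [P_n(u)] in the basis [P_k(s)], and [r u = S_n(s) / S_n(u)]. *)
Section PerturbedUnitRow.
Variables (R : realType) (n : nat) (s : R).
Variables (c : 'I_n.+1 -> R -> R[i]) (E : 'I_n.+1 -> 'I_n.+1 -> R -> R[i]).
Variables (r : R -> R[i]) (e : 'I_n.+1 -> 'I_n.+1 -> R[i]).

Hypothesis dE : forall k l, is_Cderive (E k l) s (e k l).
Hypothesis Es : forall k l, E k l s = (k == l)%:R.
Hypothesis cE : \forall u \near s, forall l,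
  \sum_(k < n.+1) c k u * E k l u = (l == ord_max)%:R * r u.
Hypothesis cr : \forall u \near s, c ord_max u * r u = 1.
Hypothesis rs : r s = 1.
Hypothesis dr : Cderivable r s.

Let M u := \matrix_(k, l) E k l u.

(** Multiplying the system on the right by the adjugate needs no invertibility of the matrix. *)
Let cramer u l : (forall l, \sum_(k < n.+1) c k u * E k l u = (l == ord_max)%:R * r u) ->
  c l u * \det (M u) = r u * (\adj (M u)) ord_max l.
Proof.
move=> h; pose v := \row_k c k u.
have vM : v *m M u = r u *: delta_mx 0 ord_max.
  apply/rowP => j; rewrite !mxE -[RHS]mulrC /= -h.
  by apply: eq_bigr => k _; rewrite !mxE.
have : v *m (M u *m \adj (M u)) = r u *: delta_mx 0 ord_max *m \adj (M u).
  by rewrite mulmxA vM.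
rewrite mul_mx_adj mul_mx_scalar -scalemxAl -rowE => /rowP/(_ l).
by rewrite !mxE mulrC.
Qed.

(** The determinant is 1 at [s], hence nonzero nearby, and Cramer's rule makes [c l] a quotient of
    differentiable functions there. *)
Let Cderivable_c l : Cderivable (c l) s.
Proof.
have dM i j : Cderivable (fun u => M u i j) s.
  by under eq_fun do rewrite mxE; exists (e i j).
have detM : \det (M s) = 1.
  rewrite (_ : M s = 1%:M) ?det1//.
  by apply/matrixP => i j; rewrite !mxE Es.
have dd : Cderivable (fun u => \det (M u)) s by exact: Cderivable_det.
have d0 : \det (M s) != 0 by rewrite detM oner_eq0.
have [m dm] : Cderivable (fun u => r u * (\adj (M u)) ord_max l * (\det (M u))^-1) s.
  apply: CderivableM; last exact: CderivableV.
  apply: CderivableM => //; under eq_fun do rewrite mxE /cofactor.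
  apply: CderivableM; first exact: Cderivable_cst.
  by apply: Cderivable_det => i j; under eq_fun do rewrite !mxE; eexists; exact: dE.
exists m; apply: near_eq_is_Cderive dm.
have := near_Cderivable_neq0 dd d0; have := cE.
by apply: filterS2 => u h h0; rewrite -(cramer l h) mulfK.
Qed.

(** At [s] the matrix is the identity and [c] is the last unit row, so the differentiated system
    reads [c'_l + e_(n,l) = delta_(l,n) r']. Differentiating [c_n r = 1] gives [r' = - c'_n], so at
    [l = n] the unknown appears twice: [2 c'_n = - e_(n,n)]. *)
Lemma is_Cderive_perturbed_unit_row l :
  is_Cderive (c l) s (- (if l == ord_max then 2^-1 else 1) * e ord_max l).
Proof.
have /choice[c' dc] : forall k, exists m, is_Cderive (c k) s m by [].
have [r' dr'] := dr.
have cs k : c k s = (k == ord_max)%:R.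
  have := nbhs_singleton cE k; rewrite rs mulr1 => <-.
  rewrite (bigD1 k)//= Es eqxx mulr1 big1 ?addr0// => i /negPf ik.
  by rewrite Es ik mulr0.
have eq1 j : c' j + e ord_max j = (j == ord_max)%:R * r'.
  have h1 := is_Cderive_sum (fun k => is_CderiveM (dc k) (dE k j)).
  have h2 := is_CderiveM (is_Cderive_cst (j == ord_max)%:R s) dr'.
  have := near_eq_is_Cderive _ h1.
  have nE : \forall u \near s, \sum_(i < n.+1) c i u * E i j u = (j == ord_max)%:R * r u.
    by have := cE; apply: filterS => u /(_ j).
  move=> /(_ _ nE)/is_Cderive_unique/(_ h2); rewrite mul0r add0r => <-.
  rewrite big_split/= (bigD1 j)//= Es eqxx mulr1 big1 ?addr0; last first.
    by move=> i /negPf ij; rewrite Es ij mulr0.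
  rewrite (bigD1 ord_max)//= cs eqxx mul1r big1 ?addr0// => i /negPf ij.
  by rewrite cs ij mul0r.
have eq2 : c' ord_max + r' = 0.
  have h1 := near_eq_is_Cderive cr (is_CderiveM (dc ord_max) dr').
  rewrite -(is_Cderive_unique h1 (is_Cderive_cst 1 s)) rs cs eqxx.
  by rewrite mulr1 mul1r.
apply: is_Cderive_eq (dc l) _; have := eq1 l.
case: eqVneq => [->|_].
  move: eq2 => /eqP; rewrite addr_eq0 => /eqP ->; rewrite mul1r => /eqP.
  rewrite addrC subr_eq -mulr2n => /eqP ->.
  by rewrite -[r' *+ 2]mulr_natl mulNr mulKf ?pnatr_eq0.
by rewrite mul0r mulN1r => /eqP; rewrite addr_eq0 => /eqP.
Qed.

End PerturbedUnitRow.

(** * Biorthonormal systems at a fixed parameter point *)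

Section Biorthonormal.
Variable R : realType.
Implicit Types (a b xi psi : R[i]) (s t : R).

Lemma assoc1_sum a xi s n (c : 'I_n -> R[i]) (P : 'I_n -> {poly R[i]}) z :
  (forall p, Cintegrable (@lebesgue_measure R) (@halfline R)
    (fun x => weight a xi s x * p.[x%:C])) -> cut_plane z ->
  assoc1 a xi s (\sum_(k < n) c k *: P k) z = \sum_(k < n) c k * assoc1 a xi s (P k) z.
Proof.
move=> wi cz; have mD := @measurable_halfline R.
have h k := Cintegrable_assoc1 (wi (P k)) cz.
transitivity (\sum_(k < n) Cintegral (@lebesgue_measure R) (@halfline R)
    (fun x => c k * (weight a xi s x / (z - x%:C) * (P k).[x%:C]))).
  rewrite -Cintegral_sum//; last by move=> k; exact: (CintegrableZ mD (c k) (h k)).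
  apply: eq_Cintegral => x _; rewrite horner_sum mulr_sumr.
  by apply: eq_bigr => k _; rewrite hornerZ mulrCA.
by apply: eq_bigr => k _; exact: (CintegralZ mD (c k) (h k)).
Qed.

(** Bundles the conditions at one point [(s, t)] so that they can be required for all nearby
    parameters and transported by exchanging the weights; [S] is common to both families, hence
    unaffected by the exchange. *)
Definition biorthonormal a b xi psi s t (S : nat -> R[i]) (P Q : nat -> {poly R[i]}) :=
  [/\ 0 < s /\ 0 < t,
      forall j k, bracket_converges a b xi psi s t (monomial j) (monomial k),
      forall n, size (P n) = n.+1 /\ size (Q n) = n.+1,
      forall n, lead_coef (P n) = S n /\ lead_coef (Q n) = S n &
      forall m n, bracket a b xi psi s t (polyfun (P m)) (polyfun (Q n)) = (m == n)%:R].

Lemma biorthonormal_swap a b xi psi s t S P Q :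
  biorthonormal a b xi psi s t S P Q -> biorthonormal b a psi xi t s S Q P.
Proof.
move=> [[s0 t0] hM hs hl ho]; split=> //.
- by move=> j k; exact: bracket_converges_swap.
- by move=> n; case: (hs n).
- by move=> n; case: (hl n).
- by move=> m n; rewrite bracket_swap ?ho 1?eq_sym//; exact: bracket_converges_poly.
Qed.

Lemma lead_neq0 a b xi psi s t S P Q n :
  biorthonormal a b xi psi s t S P Q -> S n != 0.
Proof.
by move=> [_ _ /(_ n)[hs _] /(_ n)[<- _] _]; rewrite lead_coef_eq0 -size_poly_eq0 hs.
Qed.

Section OneSystem.
Variables (a b xi psi : R[i]) (s t : R) (S : nat -> R[i]) (P Q : nat -> {poly R[i]}).
Hypothesis H : biorthonormal a b xi psi s t S P Q.

(** Pairing an expansion in the [P k] with [Q k] isolates its coefficient of index [k]. *)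
Lemma biorthonormal_expansion n (p : {poly R[i]}) : (size p <= n)%N ->
  p = \sum_(k < n) bracket a b xi psi s t (polyfun p) (polyfun (Q k)) *: P k.
Proof.
have [_ hM hs _ ho] := H.
move=> /(graded_basis_span (fun n => (hs n).1))[c cE].
rewrite [LHS]cE; apply: eq_bigr => k _; congr (_ *: _).
rewrite cE bracket_suml// (bigD1 k)//= ho eqxx mulr1 big1 ?addr0// => i /negPf ik.
by rewrite ho [(val i == val k)]ik mulr0.
Qed.

(** Expanding [q] in the [Q k], only the component along [Q n] survives, and its coefficient is
    fixed by the term of degree [n]. *)
Lemma bracket_left_lead n (q : {poly R[i]}) : (size q <= n.+1)%N ->
  bracket a b xi psi s t (polyfun (P n)) (polyfun q) = q`_n / S n.
Proof.
have [_ hM hs hl ho] := H.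
move=> /(graded_basis_span (fun n => (hs n).2))[c cE].
rewrite {2}cE (coef_graded_sum (fun n => (hs n).2)) (hl n).2 mulfK ?(lead_neq0 n H)//.
rewrite cE bracket_sumr// (bigD1 ord_max)//= ho eqxx mulr1 big1 ?addr0// => i im.
by rewrite ho eq_sym [(val i == n)](negPf im) mulr0.
Qed.

End OneSystem.

(** * Derivatives of the associated functions in the first parameter *)

Section DeriveSystem.
Variables (a b xi psi : R[i]) (s t : R) (S : nat -> R -> R[i]).
Variables (P Q : nat -> R -> {poly R[i]}).
Hypothesis H : \forall u \near s,
  biorthonormal a b xi psi u t (S^~ u) (P^~ u) (Q^~ u).
Hypothesis dS : forall n, Cderivable (S n) s.

Let Hs : biorthonormal a b xi psi s t (S^~ s) (P^~ s) (Q^~ s).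
Proof. exact: nbhs_singleton H. Qed.

Let conv : \forall u \near s, 0 < u /\
  forall j k, bracket_converges a b xi psi u t (monomial j) (monomial k).
Proof. by have := H; apply: filterS => u [[u0 _] hM _ _ _]. Qed.

Let L := xi * laguerre a s.
Let p1 k x := assoc1 a xi s (P k s) x.
Let q1 k y := assoc1 b psi t (Q k s) y.

Let half n (k : 'I_n.+1) : R[i] := if k == ord_max then 2^-1 else 1.

Let Cderivable_ratio n : Cderivable (fun u => S n s / S n u) s.
Proof.
apply: CderivableM; first exact: Cderivable_cst.
by apply: CderivableV => //; exact: lead_neq0 Hs.
Qed.

(** The pairing and [Q k] are frozen at [s]; these are the coordinates of the moving [P n u] in the
    fixed basis [P k s]. *)
Let coefP n (k : 'I_n.+1) u :=
  bracket a b xi psi s t (polyfun (P n u)) (polyfun (Q k s)).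
Let coefQ n (k : 'I_n.+1) u :=
  bracket a b xi psi s t (polyfun (P k s)) (polyfun (Q n u)).

Let expandP n u : biorthonormal a b xi psi u t (S^~ u) (P^~ u) (Q^~ u) ->
  P n u = \sum_(k < n.+1) coefP k u *: P k s.
Proof.
by move=> [_ _ hs _ _]; apply: (biorthonormal_expansion Hs); rewrite (hs n).1.
Qed.

Let expandQ n u : biorthonormal a b xi psi u t (S^~ u) (P^~ u) (Q^~ u) ->
  Q n u = \sum_(k < n.+1) coefQ k u *: Q k s.
Proof.
move=> [_ _ hs _ _].
rewrite {1}(biorthonormal_expansion (biorthonormal_swap Hs) (p := Q n u) (n := n.+1)).
  apply: eq_bigr => k _; rewrite bracket_swap//.
  by have [_ hM _ _ _] := Hs; exact: bracket_converges_poly.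
by rewrite (hs n).2.
Qed.

Lemma is_Cderive_coefP n (k : 'I_n.+1) :
  is_Cderive (coefP k) s (half k * (L * (P n s).[s%:C] * q1 k (- s%:C))).
Proof.
pose E (k l : 'I_n.+1) u := bracket a b xi psi u t (polyfun (P k s)) (polyfun (Q l s)).
pose e (k l : 'I_n.+1) := L * ((P k s).[s%:C] * - q1 l (- s%:C)).
have [_ hMs hss hls hos] := Hs.
apply: is_Cderive_eq (is_Cderive_perturbed_unit_row (c := @coefP n) (E := E) (e := e)
  (r := fun u => S n s / S n u) _ _ _ _ _ _ k) _.
- by move=> i j; exact: is_Cderive_bracket.
- by move=> i j; rewrite /E hos.
(* The sum is the pairing at [u] of [P n u] with [Q l s]. Orthogonality at [u] leaves the
   coefficient of degree [n] of [Q l s] over [S n u]: this is the ratio of leading coefficients for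
   [l = n], and 0 for [l < n]. *)
- have := H; apply: filterS => u Hu l; have [_ hM _ _ ho] := Hu.
  rewrite -bracket_suml// -expandP// (bracket_left_lead Hu) ?(hss l).2//.
  have [->|ln] := eqVneq l ord_max.
    by rewrite (coef_lead (hss n).2) (hls n).2 mul1r.
  rewrite nth_default ?mul0r// (hss l).2 ltn_neqAle -ltnS ltn_ord andbT.
  exact: ln.
(* Comparing coefficients of degree [n] in the expansion of [P n u] gives the top coordinate as
   [S n u / S n s]. *)
- have := H; apply: filterS => u Hu; have [_ hM hs hl ho] := Hu.
  have := congr1 (fun p : {poly R[i]} => p`_n) (expandP n Hu).
  rewrite (coef_graded_sum (fun n => (hss n).1)) (hls n).1.
  rewrite (coef_lead (hs n).1) (hl n).1 => h.
  by rewrite mulrA -h divff// (lead_neq0 n Hu).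
- by rewrite divff// (lead_neq0 n Hs).
- exact: Cderivable_ratio.
- rewrite /half /e /=; case: ifP => _; ring.
Qed.

Lemma is_Cderive_coefQ n (k : 'I_n.+1) :
  is_Cderive (coefQ k) s (half k * (L * q1 n (- s%:C) * (P k s).[s%:C])).
Proof.
(* The Gram matrix is transposed here, since the row index must run over the basis [Q k s]. *)
pose E (k l : 'I_n.+1) u := bracket a b xi psi u t (polyfun (P l s)) (polyfun (Q k s)).
pose e (k l : 'I_n.+1) := L * ((P l s).[s%:C] * - q1 k (- s%:C)).
have [_ hMs hss hls hos] := Hs.
apply: is_Cderive_eq (is_Cderive_perturbed_unit_row (c := @coefQ n) (E := E) (e := e)
  (r := fun u => S n s / S n u) _ _ _ _ _ _ k) _.
- by move=> i j; exact: is_Cderive_bracket.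
- by move=> i j; rewrite /E hos eq_sym.
- have := H; apply: filterS => u Hu l; have [_ hM _ _ ho] := Hu.
  rewrite -bracket_sumr// -expandQ// -bracket_swap; last exact: bracket_converges_poly.
  rewrite (bracket_left_lead (biorthonormal_swap Hu)) ?(hss l).1//.
  have [->|ln] := eqVneq l ord_max.
    by rewrite (coef_lead (hss n).1) (hls n).1 mul1r.
  rewrite nth_default ?mul0r// (hss l).1 ltn_neqAle -ltnS ltn_ord andbT.
  exact: ln.
- have := H; apply: filterS => u Hu; have [_ hM hs hl ho] := Hu.
  have := congr1 (fun p : {poly R[i]} => p`_n) (expandQ n Hu).
  rewrite (coef_graded_sum (fun n => (hss n).2)) (hls n).2.
  rewrite (coef_lead (hs n).2) (hl n).2 => h.
  by rewrite mulrA -h divff// (lead_neq0 n Hu).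
- by rewrite divff// (lead_neq0 n Hs).
- exact: Cderivable_ratio.
- rewrite /half /e /=; case: ifP => _; ring.
Qed.

(** Separates the diagonal term with its factor 1/2 from the [n] lower terms, which form the sum in
    a kernel of index [n - 1]. *)
Let halfE n (X : R[i]) (G1 G2 : 'I_n.+1 -> R[i]) :
  \sum_(k < n.+1) half k * (X * G1 k) * G2 k =
  X * (2^-1 * (G1 ord_max * G2 ord_max) +
    \sum_(k < n) G1 (widen_ord (leqnSn n) k) * G2 (widen_ord (leqnSn n) k)).
Proof.
rewrite big_ord_recr/= /half eqxx mulrDr addrC; congr (_ + _); first by ring.
rewrite mulr_sumr; apply: eq_bigr => k _.
by rewrite -val_eqE/= ltn_eqF// mul1r mulrA.
Qed.

(** Both the coordinates of [P n u] and the weight in the transform move. The coordinates produce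
    the diagonal term and the sum in [K11]; the weight produces [P_n(s) / (x - s)], the rational
    term of [K11] at [(x, -s)]. *)
Lemma is_Cderive_assoc1_left n x : cut_plane x ->
  is_Cderive (fun u => assoc1 a xi u (P n u) x) s
    (xi * laguerre a s * (P n s).[s%:C] *
     (2^-1 * p1 n x * q1 n (- s%:C)
      + K11 (fun k => p1 k) (fun k => q1 k) n x (- s%:C))).
Proof.
move=> cx; have [[_ t0] _ _ _ hos] := Hs.
have h := is_Cderive_sum (fun k : 'I_n.+1 => is_CderiveM (is_Cderive_coefP k)
  (is_Cderive_assoc1 conv (P k s) t0 cx)).
apply: is_Cderive_eq (near_eq_is_Cderive _ h) _.
  have := H; apply: filterS => u Hu; rewrite [in RHS](expandP n Hu) assoc1_sum//.
  by move=> p; have [_ hM _ _ _] := biorthonormal_swap Hu;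
    exact: (Cintegrable_weight_poly_right _ hM).
(* In the contribution of the weight only [k = n] remains, because at [u = s] the coordinates are
   those of a unit row. *)
rewrite big_split/= halfE [X in _ + X](bigD1 ord_max)//= [X in _ + (_ + X)]big1 ?addr0.
  rewrite /coefP hos eqxx mul1r /K11 /p1 /L.
  under eq_bigr do rewrite mulrC.
  by ring.
by move=> k /negPf kn; rewrite /coefP hos eq_sym [(val k == n)]kn mul0r.
Qed.

(** The second weight is independent of [s], so only the coordinates of [Q n u] are differentiated;
    hence [K01] carries no rational term. *)
Lemma is_Cderive_assoc1_right n y : cut_plane y ->
  is_Cderive (fun u => assoc1 b psi t (Q n u) y) s
    (xi * laguerre a s * q1 n (- s%:C) *
     (2^-1 * (P n s).[s%:C] * q1 n y
      + K01 (fun k z => (P k s).[z]) (fun k => q1 k) n s%:C y)).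
Proof.
move=> cy; have [[s0 _] hMs _ _ _] := Hs.
have h := is_Cderive_sum (fun k : 'I_n.+1 => is_CderiveM (is_Cderive_coefQ k)
  (is_Cderive_cst (q1 k y) s)).
apply: is_Cderive_eq (near_eq_is_Cderive _ h) _.
  have := H; apply: filterS => u Hu; rewrite [in RHS](expandQ n Hu) assoc1_sum//.
  by move=> p; exact: (Cintegrable_weight_poly_right _ hMs).
rewrite big_split/= halfE [X in _ + X]big1 ?addr0; last by move=> k _; rewrite mulr0.
by rewrite /K01 mulrA.
Qed.

End DeriveSystem.
End Biorthonormal.

(** * From two parameters to one, and the four derivative formulas *)

Lemma Cdifferentiable2_Cderivable (R : realType) (f : R -> R -> R[i]) (s t : R) :
  Cdifferentiable2 f s t ->
  Cderivable (fun u => f u t) s /\ Cderivable (fun u => f s u) t.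
Proof.
move=> [f1 f2].
have d1 : differentiable (fun u : R => (u, t)) s by [].
have d2 : differentiable (fun u : R => (s, u)) t by [].
have dd (g : R * R -> R) : differentiable g (s, t) ->
  derivable (fun u => g (u, t)) s 1 /\ derivable (fun u => g (s, u)) t 1.
  move=> dg; split; apply/derivable1_diffP.
  - exact: (differentiable_comp d1 dg).
  - exact: (differentiable_comp d2 dg).
have [a1 b1] := dd _ f1; have [a2 b2] := dd _ f2.
split.
- exact: (@derivable_Cderivable _ (fun u => f u t) s a1 a2).
- exact: (@derivable_Cderivable _ (fun u => f s u) t b1 b2).
Qed.

Unset Implicit Arguments.
Set Strict Implicit.

Theorem proposition4p5 (R : realType) (a b xi psi : R[i])
  (ha : -1 < complex.Re a) (hb : -1 < complex.Re b)
  (U : set (R * R)) (hUopen : open U)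
  (hUpos : forall s t : R, U (s, t) -> 0 < s /\ 0 < t)
  (S : nat -> R -> R -> R[i])
  (P Q : nat -> R -> R -> {poly R[i]})
  (hM : forall (s t : R) (j k : nat), U (s, t) ->
    bracket_converges a b xi psi s t (monomial j) (monomial k))
  (hZ : forall (s t : R) (n : nat), U (s, t) -> Zdet a b xi psi s t n != 0)
  (hS : forall (s t : R) (n : nat), U (s, t) ->
    S n s t ^+ 2 = Zdet a b xi psi s t n / Zdet a b xi psi s t n.+1)
  (hSdiff : forall (s t : R) (n : nat), U (s, t) -> Cdifferentiable2 (S n) s t)
  (hPdeg : forall (s t : R) (n : nat), U (s, t) -> size (P n s t) = n.+1)
  (hQdeg : forall (s t : R) (n : nat), U (s, t) -> size (Q n s t) = n.+1)
  (hPlead : forall (s t : R) (n : nat), U (s, t) -> lead_coef (P n s t) = S n s t)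
  (hQlead : forall (s t : R) (n : nat), U (s, t) -> lead_coef (Q n s t) = S n s t)
  (horth : forall (s t : R) (m n : nat), U (s, t) ->
    bracket a b xi psi s t (polyfun (P m s t)) (polyfun (Q n s t)) = (m == n)%:R)
  (hPint : forall (s t : R) (n : nat), U (s, t) ->
    weight_integral a xi s (P n s t) != 0)
  (hQint : forall (s t : R) (n : nat), U (s, t) ->
    weight_integral b psi t (Q n s t) != 0) :
  let p (s t : R) (n : nat) (z : R[i]) := (P n s t).[z] in
  let q (s t : R) (n : nat) (z : R[i]) := (Q n s t).[z] in
  let p1 (s t : R) (n : nat) (z : R[i]) := assoc1 a xi s (P n s t) z in
  let q1 (s t : R) (n : nat) (z : R[i]) := assoc1 b psi t (Q n s t) z in
  forall (n : nat) (s t : R) (x y : R[i]),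
    U (s, t) -> @cut_plane R x -> @cut_plane R y ->
    [/\ is_Cderive (fun u => p1 u t n x) s
          (xi * laguerre a s * p s t n s%:C *
           (2^-1 * p1 s t n x * q1 s t n (- s%:C)
            + K11 (p1 s t) (q1 s t) n x (- s%:C))),
        is_Cderive (fun u => q1 u t n y) s
          (xi * laguerre a s * q1 s t n (- s%:C) *
           (2^-1 * p s t n s%:C * q1 s t n y
            + K01 (p s t) (q1 s t) n s%:C y)),
        is_Cderive (fun u => p1 s u n x) t
          (psi * laguerre b t * p1 s t n (- t%:C) *
           (2^-1 * p1 s t n x * q s t n t%:C
            + K10 (p1 s t) (q s t) n x t%:C)) &
        is_Cderive (fun u => q1 s u n y) t
          (psi * laguerre b t * q s t n t%:C *
           (2^-1 * p1 s t n (- t%:C) * q1 s t n y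
            + K11 (p1 s t) (q1 s t) n (- t%:C) y))].
Proof.
move=> p q p1 q1 n s t x y Ust cx cy.
have bi u v : U (u, v) -> biorthonormal a b xi psi u v
    (fun n => S n u v) (fun n => P n u v) (fun n => Q n u v).
  move=> Uuv; split.
  - exact: hUpos.
  - by move=> j k; exact: hM.
  - by move=> m; split; [exact: hPdeg|exact: hQdeg].
  - by move=> m; split; [exact: hPlead|exact: hQlead].
  - by move=> i j; exact: horth.
have nU : nbhs (s, t) U by exact: open_nbhs_nbhs.
(* Openness of [U] and continuity of the two coordinate lines through [(s, t)] keep the hypotheses
   available while one parameter varies. *)
have nUs : \forall u \near s, U (u, t).
  have d1 : differentiable (fun u : R => (u, t)) s by [].
  exact: (differentiable_continuous d1).
have nUt : \forall u \near t, U (s, u).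
  have d2 : differentiable (fun u : R => (s, u)) t by [].
  exact: (differentiable_continuous d2).
have Hs : \forall u \near s, biorthonormal a b xi psi u t
    (fun n => S n u t) (fun n => P n u t) (fun n => Q n u t).
  by apply: filterS nUs => u; exact: bi.
(* After the exchange of weights [t] is the first parameter and [Q] the first family. *)
have Ht : \forall u \near t, biorthonormal b a psi xi u s
    (fun n => S n s u) (fun n => Q n s u) (fun n => P n s u).
  by apply: filterS nUt => u /bi/biorthonormal_swap.
have dSs m := (Cdifferentiable2_Cderivable (hSdiff s t m Ust)).1.
have dSt m := (Cdifferentiable2_Cderivable (hSdiff s t m Ust)).2.
split.
- exact: (is_Cderive_assoc1_left Hs dSs n cx).
- exact: (is_Cderive_assoc1_right Hs dSs n cy).
(* In the exchanged system [P] is the second family, so its [t]-derivative is an instance of the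
   right-hand formula, with [K01] becoming [K10]. *)
- apply: is_Cderive_eq (is_Cderive_assoc1_right Ht dSt n cx) _.
  rewrite /K01 /K10; under eq_bigr do rewrite mulrC.
  rewrite /p1 /q; ring.
- apply: is_Cderive_eq (is_Cderive_assoc1_left Ht dSt n cy) _.
  (* Under the exchange [K11] only has its two arguments and the factors of each product
     interchanged. *)
  rewrite /K11 [y + _]addrC; under eq_bigr do rewrite mulrC.
  rewrite /p1 /q1 /q; ring.
Qed.
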